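(* For any $f,g\in L^{\infty}_1(\ell_2)$, the product $fg$ has a finite upper frame bound, i.e. there is a constant $B<\infty$ such that $\sum_{m,n\in\mathbb Z}|\langle h,E_mT_n(fg)\rangle|^2\le B\|h\|^2_{L^2(\mathbb R)}$ for all $h\in L^2(\mathbb R)$. In particular, the Zak space $X_Z$ is an ideal of $L^{\infty}_1(\ell_2)$, regarded as an algebra under pointwise multiplication.
   Context: $L^{\infty}_1(\ell_2)$ is the set of measurable functions $f:\mathbb R\to\mathbb C$ (identified when equal a.e.) with $\|f\|^2_{L^{\infty}_1(\ell_2)}=\operatorname*{ess\,sup}_{x\in[0,1]}\sum_{k\in\mathbb Z}|f(x-k)|^2<\infty$; it is contained in $L^2(\mathbb R)$ and is an algebra under pointwise multiplication. For $a,b\in\mathbb R$, $T_af(x)=f(x-a)$ (translation) and $E_bf(x)=e^{2\pi i b x}f(x)$ (modulation). The Zak transform of $f\in L^2(\mathbb R)$ is $Z(f)(t,v)=\sum_{k\in\mathbb Z}f(t-k)e^{2\pi i k v}$, $t,v\in\mathbb R$; it gives a unitary operator from $L^2(\mathbb R)$ onto $L^2([0,1]^2)$. The Zak space is $X_Z=\{f\in L^2(\mathbb R): \|f\|_{X_Z}=\operatorname*{ess\,sup}_{(t,v)\in[0,1]^2}|Z(f)(t,v)|<\infty\}$. It is the set of functions $f\in L^2(\mathbb R)$ such that the Gabor system $\{E_mT_nf\}_{m,n\in\mathbb Z}$ has a finite upper frame bound. *)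

(* Defs.v *)
From HB Require Import structures.
From mathcomp Require Import all_boot all_order all_algebra.
From mathcomp Require Import all_classical all_reals all_analysis.
From mathcomp Require Import ess_sup_inf.
From mathcomp.real_closed Require Import complex.

Set Implicit Arguments.
Unset Strict Implicit.
Unset Printing Implicit Defensive.

Import Order.TTheory GRing.Theory Num.Theory.
Import numFieldNormedType.Exports.
Import Normc.

Local Open Scope classical_set_scope.
Local Open Scope ring_scope.
Local Open Scope complex_scope.

(* A class of functions modulo a.e. equality is represented by any of its
   (Borel) measurable members; sets of classes are the sets of measurable
   functions that are stable under a.e. equality, see [ae_stable]. *)
Section complex_functions.
Context {R : realType}.
Implicit Types (f g h : R -> R[i]) (a b : R).

Local Notation leb := (@lebesgue_measure R).

Definition cmeasurable d (T : measurableType d) (D : set T) (F : T -> R[i]) :=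
  measurable_fun D (fun x => complex.Re (F x)) /\
  measurable_fun D (fun x => complex.Im (F x)).

(* e^(i theta) *)
Definition cis (theta : R) : R[i] := cos theta +i* sin theta.

Definition cintegral (F : R -> R[i]) : R[i] :=
  (\int[leb]_x complex.Re (F x)) +i* (\int[leb]_x complex.Im (F x)).

Definition L2_norm_sq f : \bar R :=
  (\int[leb]_x ((normc (f x)) ^+ 2)%:E)%E.

Definition L2 : set (R -> R[i]) :=
  [set f | cmeasurable setT f /\ (L2_norm_sq f < +oo)%E].

Definition inner f g : R[i] := cintegral (fun x => f x * (g x)^*).

Definition translation a f : R -> R[i] := fun x => f (x - a).

Definition modulation b f : R -> R[i] := fun x => cis (2 * pi * b * x) * f x.

Definition unit_itv : set (measurableTypeR R) := `[0, 1]%classic.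

Lemma measurable_unit_itv : measurable unit_itv.
Proof. exact: measurable_itv. Qed.

Definition leb_unit_itv := mrestr leb measurable_unit_itv.

Definition unit_square : set (measurableTypeR R * measurableTypeR R) :=
  unit_itv `*` unit_itv.

Lemma measurable_unit_square : measurable unit_square.
Proof. by apply: measurableX; exact: measurable_unit_itv. Qed.

Definition leb_unit_square :=
  mrestr (leb \x leb)%E measurable_unit_square.

Definition amalgam_norm_sq f : \bar R :=
  ess_sup leb_unit_itv
    (fun x => \esum_(k in [set: int]) ((normc (f (x - k%:~R))) ^+ 2)%:E).

(* L^oo_1(l_2) *)
Definition amalgam : set (R -> R[i]) :=
  [set f | cmeasurable setT f /\ (amalgam_norm_sq f < +oo)%E].

(* \sum_(-n <= k <= n) f(t - k) e^(2 pi i k v), with k = j - n *)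
Definition zak_partial f (n : nat) (tv : R * R) : R[i] :=
  \sum_(j < n.*2.+1)
    let k : R := ((j : nat)%:Z - n%:Z)%:~R in
    f (tv.1 - k) * cis (2 * pi * k * tv.2).

(* For a general f in L^2(R) the series defining Z(f) converges in
   L^2([0,1]^2); F represents its sum, determined a.e. on [0,1]^2. *)
Definition is_zak_transform f (F : R * R -> R[i]) :=
  cmeasurable unit_square F /\
  (fun n => (\int[leb \x leb]_(p in unit_square)
               ((normc (zak_partial f n p - F p)) ^+ 2)%:E)%E) @ \oo --> 0%E.

Definition zak_space : set (R -> R[i]) :=
  [set f | L2 f /\ exists2 F, is_zak_transform f F &
     (ess_sup leb_unit_square (fun p => (normc (F p))%:E) < +oo)%E].

Definition finite_upper_frame_bound f :=
  L2 f /\ exists B : R, forall h, L2 h ->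
    (\esum_(mn in [set: int * int])
       ((normc (inner h (modulation mn.1%:~R (translation mn.2%:~R f)))) ^+ 2)%:E
     <= B%:E * L2_norm_sq h)%E.

Definition ae_stable (V : set (R -> R[i])) :=
  forall f g, V f -> cmeasurable setT g ->
    (\forall x \ae leb, f x = g x) -> V g.

Definition function_subspace (V : set (R -> R[i])) :=
  [/\ V `<=` cmeasurable setT, ae_stable V, V (cst 0),
      forall f g, V f -> V g -> V (f \+ g) &
      forall (c : R[i]) f, V f -> V (c \*o f)].

Definition function_algebra (A : set (R -> R[i])) :=
  function_subspace A /\ forall f g, A f -> A g -> A (f \* g).

Definition is_ideal (A I : set (R -> R[i])) :=
  [/\ function_algebra A, function_subspace I, I `<=` A &
      forall f g, A f -> I g -> I (f \* g)].

End complex_functions.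

(* Main.v *)
Require Import Defs.
From mathcomp Require Import all_boot all_order all_algebra.
From mathcomp Require Import all_classical all_reals all_analysis.
From mathcomp Require Import measurable_realfun ess_sup_inf zify ring lra.
From mathcomp.real_closed Require Import complex.

(* Write [S_u x] for the periodization [\sum_k u (x - k)]. If [f] and [g] lie in the
   amalgam, then [S_|fg| <= (S_|f|^2 + S_|g|^2) / 2] is essentially bounded, by [C]
   say. For such a [phi = fg], a finite sum [\sum_(m, n) c_mn E_m T_n phi] equals
   [\sum_n p_n T_n phi] with trigonometric polynomials [p_n]; the weighted
   Cauchy-Schwarz inequality, periodization and Parseval bound its squared L^2 norm
   by [C^2 \sum |c_mn|^2], which by duality is the frame bound [C^2].
   The symmetric partial sums of the Zak transform of [phi] converge absolutely and
   boundedly for almost every [t], hence in L^2 of the square by dominated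
   convergence, so [phi] lies in the Zak space. Conversely, for [f] in the Zak space,
   Parseval in the second variable turns the bound on [Z f] into one on
   [\sum_k |f (t - k)|^2]. *)

Set Implicit Arguments.
Unset Strict Implicit.
Unset Printing Implicit Defensive.

Import Order.TTheory GRing.Theory Num.Theory.
Import numFieldNormedType.Exports.
Import Normc.

Local Open Scope classical_set_scope.
Local Open Scope ring_scope.
Local Open Scope complex_scope.

Local Notation Re := complex.Re.
Local Notation Im := complex.Im.

(** * Complex numbers *)

Section complex_facts.
Context {R : realType}.
Implicit Types (w z : R[i]) (a b : R) (k : int).

Lemma sqr_normcE z : normc z ^+ 2 = Re z ^+ 2 + Im z ^+ 2.
Proof. by case: z => a b /=; rewrite sqr_sqrtr// addr_ge0// sqr_ge0. Qed.

Lemma normc_ge0 z : 0 <= normc z.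
Proof. by case: z => a b; exact: sqrtr_ge0. Qed.

Lemma ReD w z : Re (w + z) = Re w + Re z.
Proof. by case: w; case: z. Qed.

Lemma ImD w z : Im (w + z) = Im w + Im z.
Proof. by case: w; case: z. Qed.

Lemma ReM w z : Re (w * z) = Re w * Re z - Im w * Im z.
Proof. by case: w; case: z. Qed.

Lemma ImM w z : Im (w * z) = Re w * Im z + Im w * Re z.
Proof. by case: w; case: z. Qed.

Lemma ReJ z : Re (conjc z) = Re z. Proof. by case: z. Qed.

Lemma ImJ z : Im (conjc z) = - Im z. Proof. by case: z. Qed.

(* [inner] is stated with [Num.conj], which is convertible to [conjc] but does not
   match it syntactically; [conjc] is used throughout. *)
Lemma conjcM w z : conjc (w * z) = conjc w * conjc z.
Proof. exact: (rmorphM (@conjc R)). Qed.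

Lemma conjc_sum (I : Type) (r : seq I) (F : I -> R[i]) :
  conjc (\sum_(i <- r) F i) = \sum_(i <- r) conjc (F i).
Proof. exact: (raddf_sum (@conjc R)). Qed.

Lemma Re_sum (I : Type) (r : seq I) (F : I -> R[i]) :
  Re (\sum_(i <- r) F i) = \sum_(i <- r) Re (F i).
Proof. exact: (big_morph _ ReD). Qed.

Lemma sqr_normcD_le w z :
  normc (w + z) ^+ 2 <= 2 * (normc w ^+ 2 + normc z ^+ 2).
Proof.
rewrite !sqr_normcE ReD ImD.
have := sqr_ge0 (Re w - Re z); have := sqr_ge0 (Im w - Im z); nra.
Qed.

Lemma normc_sum_le (I : Type) (r : seq I) (F : I -> R[i]) :
  normc (\sum_(i <- r) F i) <= \sum_(i <- r) normc (F i).
Proof.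
elim: r => [|i r IH]; first by rewrite !big_nil normc0.
by rewrite !big_cons (le_trans (le_normcD _ _))// lerD2l.
Qed.

Lemma normr_Re_le z : `|Re z| <= normc z.
Proof.
by rewrite -ler_sqr ?nnegrE ?normc_ge0// real_normK ?num_real// sqr_normcE lerDl sqr_ge0.
Qed.

Lemma normr_Im_le z : `|Im z| <= normc z.
Proof.
by rewrite -ler_sqr ?nnegrE ?normc_ge0// real_normK ?num_real// sqr_normcE lerDr sqr_ge0.
Qed.

Lemma normc_le_ReIm z : normc z <= `|Re z| + `|Im z|.
Proof.
rewrite -ler_sqr ?nnegrE ?normc_ge0 ?addr_ge0// sqr_normcE sqrrD.
rewrite !real_normK ?num_real// -addrA lerD2l addrC lerDl.
by rewrite pmulrn_lge0 ?mulr_ge0.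
Qed.

Lemma normc_cis a : normc (cis a) = 1.
Proof. by rewrite /cis /= cos2Dsin2 sqrtr1. Qed.

Lemma cisD a b : cis (a + b) = cis a * cis b.
Proof.
by rewrite /cis cosD sinD; apply/eqP; rewrite eq_complex /= eqxx/= addrC.
Qed.

Lemma cis0 : cis 0 = 1 :> R[i].
Proof. by rewrite /cis cos0 sin0. Qed.

Lemma cisN a : cis (- a) = conjc (cis a).
Proof. by rewrite /cis cosN sinN. Qed.

Lemma cis_2pi_int k : cis (2 * pi * k%:~R) = 1 :> R[i].
Proof.
have H (n : nat) : cis (2 * pi * n%:R) = 1 :> R[i].
  elim: n => [|n IH]; first by rewrite mulr0 cis0.
  rewrite -[n.+1%:R]natr1 mulrDr cisD IH mul1r mulr1 /cis mulr_natl.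
  by rewrite cos2pi sin2pi.
case: k => n; first exact: H.
by rewrite NegzE mulrNz mulrN cisN -pmulrn H conjc1.
Qed.

Lemma cis_periodic k k' a : cis (2 * pi * k%:~R * (a - k'%:~R)) = cis (2 * pi * k%:~R * a) :> R[i].
Proof.
have -> : 2 * pi * k%:~R * (a - k'%:~R)
    = 2 * pi * k%:~R * a + 2 * pi * (- (k * k'))%:~R :> R.
  by rewrite mulrNz intrM; ring.
by rewrite cisD cis_2pi_int mulr1.
Qed.

End complex_facts.

(** * Measurability of complex-valued functions *)

Section complex_measurability.
Context {R : realType} d (T : measurableType d).
Implicit Types (D : set T) (F G : T -> R[i]).

Lemma cmeasurable_cst D (c : R[i]) : cmeasurable D (fun=> c).
Proof. by split; exact: measurable_cst. Qed.

Lemma cmeasurableD D F G : cmeasurable D F -> cmeasurable D G ->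
  cmeasurable D (fun x => F x + G x).
Proof.
move=> [F1 F2] [G1 G2]; split.
  by under eq_fun do rewrite ReD; exact: measurable_funD.
by under eq_fun do rewrite ImD; exact: measurable_funD.
Qed.

Lemma cmeasurableM D F G : cmeasurable D F -> cmeasurable D G ->
  cmeasurable D (fun x => F x * G x).
Proof.
move=> [F1 F2] [G1 G2]; split.
  under eq_fun do rewrite ReM.
  by apply: measurable_funB; exact: measurable_funM.
under eq_fun do rewrite ImM.
by apply: measurable_funD; exact: measurable_funM.
Qed.

Lemma cmeasurable_conj D F : cmeasurable D F -> cmeasurable D (fun x => conjc (F x)).
Proof.
move=> [F1 F2]; split; first by under eq_fun do rewrite ReJ.
under eq_fun do rewrite ImJ.
exact: measurableT_comp.
Qed.

Lemma cmeasurable_sum (I : Type) (r : seq I) D (F : I -> T -> R[i]) :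
  (forall i, cmeasurable D (F i)) -> cmeasurable D (fun x => \sum_(i <- r) F i x).
Proof.
move=> mF; elim: r => [|i r IH].
  by under eq_fun do rewrite big_nil; exact: cmeasurable_cst.
by under eq_fun do rewrite big_cons; exact: cmeasurableD.
Qed.

Lemma cmeasurable_cis D (u : T -> R) : measurable_fun D u ->
  cmeasurable D (fun x => cis (u x)).
Proof.
by move=> mu; split; apply: measurableT_comp => //; apply: continuous_measurable_fun;
  [exact: continuous_cos|exact: continuous_sin].
Qed.

Lemma measurable_sqr_normc D F : cmeasurable D F ->
  measurable_fun D (fun x => normc (F x) ^+ 2).
Proof.
move=> [F1 F2]; under eq_fun do rewrite sqr_normcE.
by apply: measurable_funD; exact: measurable_funX.
Qed.

Lemma measurable_normc D F : cmeasurable D F ->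
  measurable_fun D (fun x => normc (F x)).
Proof.
move=> mF; have -> : (fun x => normc (F x)) = (fun x => Num.sqrt (normc (F x) ^+ 2)).
  by apply/funext => x; rewrite sqrtr_sqr ger0_norm// normc_ge0.
apply: measurableT_comp; last exact: measurable_sqr_normc.
by apply: continuous_measurable_fun; exact: sqrt_continuous.
Qed.

End complex_measurability.

Lemma cmeasurable_comp {R : realType} d d' (T : measurableType d)
    (T' : measurableType d') (D : set T) (F : T' -> R[i]) (u : T -> T') :
  cmeasurable setT F -> measurable_fun D u -> cmeasurable D (fun x => F (u x)).
Proof. by move=> [F1 F2] mu; split; [exact: (measurableT_comp F1 mu)|exact: (measurableT_comp F2 mu)]. Qed.
(** * Periodization of integrals *)

Section esum_facts.
Context {R : realType} (I : choiceType).
Implicit Types (r : seq I) (a : I -> \bar R).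
Local Open Scope ereal_scope.

(** This and [esum_le] trade the finite subsets in the definition of [\esum] for duplicate-free
    lists, so that lemmas on finite big sums apply. *)
Lemma sum_le_esum r a : uniq r -> (forall i, 0 <= a i) ->
  \sum_(i <- r) a i <= \esum_(i in [set: I]) a i.
Proof.
move=> ur a0; apply: esum_ge; exists [set` r]; first by split.
by rewrite fsbig_seq.
Qed.

Lemma esum_le a (M : \bar R) :
  (forall r, uniq r -> \sum_(i <- r) a i <= M) ->
  \esum_(i in [set: I]) a i <= M.
Proof.
move=> H; apply: ge_ereal_sup => _ /= [A [finA _] <-].
by rewrite fsbig_finite//; exact/H/finmap.fset_uniq.
Qed.

Lemma esumZl a (c : R) : (0 <= c)%R -> (forall i, 0 <= a i) ->
  \esum_(i in [set: I]) (c%:E * a i) = c%:E * \esum_(i in [set: I]) a i.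
Proof.
move=> c0 a0; apply/eqP; rewrite eq_le; apply/andP; split.
  apply: esum_le => r ur; rewrite -ge0_sume_distrr//.
  by apply: lee_wpmul2l; [rewrite lee_fin|exact: sum_le_esum].
(* The reverse inequality divides by [c]. For [c = 0] the left-hand side is [0], even when the sum
   is infinite. *)
have [->|cneq0] := eqVneq c 0%R.
  by rewrite mul0e; apply: esum_ge0 => i _; rewrite mul0e.
have cgt0 : (0 < c)%R by rewrite lt_neqAle eq_sym cneq0.
rewrite -lee_pdivlMl//; apply: esum_le => r ur.
rewrite lee_pdivlMl// ge0_sume_distrr//.
by apply: sum_le_esum => // i; rewrite mule_ge0.
Qed.

End esum_facts.

Lemma sumr_le_subset_uniq {R : realDomainType} (I : eqType) (r rr : seq I) (F : I -> R) :
  uniq r -> uniq rr -> {subset r <= rr} -> (forall i, 0 <= F i) ->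
  \sum_(i <- r) F i <= \sum_(i <- rr) F i.
Proof.
move=> ur urr srr F0.
rewrite [leRHS](perm_big (r ++ [seq i <- rr | i \notin r])); last first.
  apply: uniq_perm => //.
    rewrite cat_uniq ur filter_uniq//= andbT.
    by apply/hasPn => i; rewrite mem_filter => /andP[].
  move=> i; rewrite mem_cat mem_filter.
  by case: (boolP (i \in r)) => [/srr|].
by rewrite big_cat/= lerDl sumr_ge0.
Qed.

Section integer_esum.
Context {R : realType}.
Implicit Types (a : int -> \bar R).
Local Open Scope ereal_scope.

Lemma esum_int_shift a (n : int) :
  \esum_(k in [set: int]) a (k + n)%R = \esum_(k in [set: int]) a k.
Proof.
apply/esym/reindex_esum; split => //; first by move=> x y _ _ /addIr.
by move=> x _; exists (x - n)%R => //; rewrite subrK.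
Qed.

(** The integers are countable and, since [Posz] is injective, infinite. The enumeration turns sums
    over the integers into series, whose terms can be integrated one by one. *)
Lemma ex_set_bij_nat_int : exists e : nat -> int, set_bij [set: nat] [set: int] e.
Proof.
have /card_set_bijP[f] : ([set: int] #= [set: nat])%card.
  apply: (eq_card_nat (countableP _)).
  move=> /(@finite_preimage _ _ _ Posz); rewrite preimage_setT => fin.
  by apply: infinite_nat; apply: fin => m n _ _ [].
rewrite setTT_bijective => -[e fK eK].
by exists e; rewrite setTT_bijective; exists f.
Qed.

End integer_esum.

(** * Translation invariance and periodization of the Lebesgue integral *)

Section lebesgue_periodization.
Context {R : realType}.
Local Notation leb := (@lebesgue_measure R).
Implicit Types (G : R -> \bar R).

Lemma measurable_shift (c : R) : measurable_fun setT (fun x : R => x - c).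
Proof. exact: measurable_funB. Qed.

Lemma measurable_comp_shift G (c : R) : measurable_fun setT G ->
  measurable_fun setT (fun x : R => G (x - c)).
Proof. move=> mG; exact: (measurableT_comp mG (measurable_shift c)). Qed.

(** By uniqueness of Lebesgue measure it is enough to compare the two measures on half-open
    intervals. *)
Lemma lebesgue_measure_shift (c : R) (A : set (measurableTypeR R)) : measurable A ->
  leb A = pushforward leb (fun x : R => x - c : measurableTypeR R) A.
Proof.
apply: lebesgue_measure_unique => //=; first exact: measurable_shift.
move=> _ _ [[a b] _ <-].
rewrite /pushforward /=.
have -> : (fun x : R => x - c) @^-1` `]a, b]%classic = `]a + c, b + c]%classic.
  by apply/seteqP; split=> x /=; rewrite !in_itv/= ltrBrDr lerBlDr.
rewrite !lebesgue_measure_itv /= !lte_fin ltrD2r; case: ifP => // _.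
by rewrite -!EFinB; congr EFin; ring.
Qed.

Local Open Scope ereal_scope.

Lemma integral_shift G (c : R) (D : set R) : measurable D ->
  measurable_fun setT G -> (forall x, 0 <= G x) ->
  \int[leb]_(x in D) G x = \int[leb]_(x in (fun x : R => x - c)%R @^-1` D) G (x - c)%R.
Proof.
move=> mD mG G0.
pose phi := (fun x : R => x - c : measurableTypeR R)%R.
transitivity (\int[pushforward leb phi]_(x in D) G x).
  apply: eq_measure_integral => //=; first exact: measurable_shift.
  by move=> _ A mA _; exact: lebesgue_measure_shift.
rewrite ge0_integral_pushforward//; first exact: measurable_shift.
exact: measurable_funTS.
Qed.

Lemma measurable_esum_shift G : measurable_fun setT G -> (forall x, 0 <= G x) ->
  measurable_fun setT (fun x : R => \esum_(k in [set: int]) G (x - k%:~R)%R).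
Proof.
move=> mG G0; have [e be] := ex_set_bij_nat_int.
under eq_fun do rewrite (reindex_esum _ _ _ _ be) -nneseries_esumT//.
apply: ge0_emeasurable_sum => // n _; exact: measurable_comp_shift.
Qed.

(** The line is tiled by integer translates of [[0, 1)]. Each tile is shifted back to the unit
    interval, and sum and integral are exchanged by nonnegativity. *)
Lemma integral_periodization G : measurable_fun setT G -> (forall x, 0 <= G x) ->
  \int[leb]_x G x =
  \int[leb]_(x in unit_itv) \esum_(k in [set: int]) G (x - k%:~R)%R.
Proof.
move=> mG G0; have [e be] := ex_set_bij_nat_int.
pose F n : set R := `[(- (e n)%:~R)%R, (1 - (e n)%:~R)%R[%classic.
have FT : \bigcup_n F n = setT.
  rewrite -subTset => x _; have [n _ en] : exists2 n, True & e n = (- Num.floor x)%R.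
    by case: be => _ _ /(_ (- Num.floor x)%R I).
  exists n => //; rewrite /F/= in_itv/= en mulrNz opprK.
  have /andP[-> /=] := floor_itv x.
  by rewrite intrD addrC.
rewrite -FT ge0_integral_bigcup//; last 3 first.
- by move=> n; exact: measurable_itv.
- by rewrite FT.
- apply/trivIsetP => i j _ _ ij; rewrite -subset0 => x.
  rewrite /F/= !in_itv/= => -[/andP[i1 i2] /andP[j1 j2]].
  case: be => _ inj _; move/eqP: ij; apply; apply: inj; rewrite ?inE//.
  (* A common point of two tiles forces their integer indices to differ by less than [1]. *)
  apply/eqP; rewrite eq_le; apply/andP; split; rewrite -ltzD1 -(ltr_int R) intrD.
    lra.
  lra.
under [RHS]eq_integral do rewrite (reindex_esum _ _ _ _ be) -nneseries_esumT//.
(* [unit_itv] is closed while the tiles are half-open; the endpoint [1] is a null set. *)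
rewrite -integral_itv_bndo_bndc; last first.
  apply: measurable_funTS.
  by apply: ge0_emeasurable_sum => // n _; exact: measurable_comp_shift.
rewrite integral_nneseries//; last first.
  by move=> n; apply: measurable_funTS; exact: measurable_comp_shift.
apply: eq_eseriesr => n _; rewrite (integral_shift (e n)%:~R)//; last exact: measurable_itv.
congr integral.
rewrite /F; apply/seteqP; split => x /=;
  by rewrite !in_itv/= -{1}[(- (e n)%:~R)%R]add0r lerD2r ltrD2r.
Qed.

End lebesgue_periodization.
(** * Trigonometric polynomials *)

Section trigonometric_polynomials.
Context {R : realType}.
Local Notation leb := (@lebesgue_measure R).
Implicit Types (a : R[i]) (c : int -> R[i]) (s : seq int) (d : int).

Lemma lebesgue_unit_itv : leb unit_itv = 1%E.
Proof. by rewrite lebesgue_measure_itv/= lte_fin ltr01 oppr0 adde0. Qed.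

Lemma continuous_Re_cis a (w : R) : continuous (fun v : R => Re (a * cis (w * v))).
Proof.
have -> : (fun v : R => Re (a * cis (w * v))) =
    (fun v : R => Re a * cos (w * v) - Im a * sin (w * v)).
  by apply/funext => v; rewrite ReM.
move=> v; apply: cvgB; apply: cvgM; try exact: cvg_cst.
  apply: continuous_comp; last exact: continuous_cos.
  exact: mulrl_continuous.
apply: continuous_comp; last exact: continuous_sin.
exact: mulrl_continuous.
Qed.

Lemma is_derive_Re_cis a (w v : R) : w != 0 ->
  is_derive v 1 (fun u : R => (Re a * sin (w * u) + Im a * cos (w * u)) / w) (Re (a * cis (w * v))).
Proof.
move=> w0.
have dw : is_derive v 1 (fun u : R => w * u) w.
  by apply: is_derive_eq; rewrite /= ?scaler0 ?addr0 /GRing.scale/= mulr1.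
have ds : is_derive v 1 (fun u : R => sin (w * u)) (cos (w * v) * w).
  have := @is_derive1_comp R sin (fun u : R => w * u) v _ _ (is_derive_sin (w * v)) dw.
  by apply.
have dc : is_derive v 1 (fun u : R => cos (w * u)) (- sin (w * v) * w).
  have := @is_derive1_comp R cos (fun u : R => w * u) v _ _ (is_derive_cos (w * v)) dw.
  by apply.
apply: is_derive_eq; rewrite ReM /= /GRing.scale/=.
by field.
Qed.

(** Orthogonality of characters: for [d != 0] the primitive takes the same value at [0] and [1],
    because [cis (2 * pi * d%:~R) = 1]. The coefficient [a] stands inside because [Re] is not
    complex linear. *)
Lemma integral_Re_cis a d :
  (\int[leb]_(v in unit_itv) (Re (a * cis (2 * pi * d%:~R * v)))%:E
   = (if d == 0 then Re a else 0)%:E)%E.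
Proof.
have [->|d0] := eqVneq d 0.
  under eq_integral do rewrite mulr0 mul0r cis0 mulr1.
  rewrite integral_cst; last exact: measurable_unit_itv.
  by rewrite [X in (_ * X)%E]lebesgue_unit_itv mule1.
set w : R := 2 * pi * d%:~R.
have w0 : w != 0 by rewrite !mulf_neq0// ?intr_eq0// gt_eqF// pi_gt0.
pose F (u : R) : R := (Re a * sin (w * u) + Im a * cos (w * u)) / w.
apply: (etrans (@continuous_FTC2 R (fun v : R => Re (a * cis (w * v))) F 0 1 _ _ _ _)) => //.
- exact/continuous_subspaceT/continuous_Re_cis.
- have cF : continuous (fun u : R => (Re a * sin (w * u) + Im a * cos (w * u)) / w).
    move=> v; apply: differentiable_continuous; apply/derivable1_diffP.
    by have [] := is_derive_Re_cis a v w0.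
  split.
  + by move=> v _; have [] := is_derive_Re_cis a v w0.
  + by apply: cvg_at_right_filter; exact: cF.
  + by apply: cvg_at_left_filter; exact: cF.
- move=> v _; rewrite derive1E.
  by have [_ ->] := is_derive_Re_cis a v w0.
- rewrite /F; have := congr1 (@complex.Re R) (cis_2pi_int d).
  have := congr1 (@complex.Im R) (cis_2pi_int d).
  rewrite /= -/w => sw cw.
  by rewrite !mulr1 !mulr0 sin0 cos0 sw cw -EFinB subrr.
Qed.

(** The square [|S|^2 = Re (S * conjc S)] expands into a double sum of characters of frequency
    [j - l], of which only the diagonal survives integration. *)
Lemma parseval_trigonometric s c : uniq s ->
  (\int[leb]_(v in unit_itv)
     (normc (\sum_(j <- s) c j * cis (2 * pi * j%:~R * v)) ^+ 2)%:E
   = (\sum_(j <- s) normc (c j) ^+ 2)%:E)%E.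
Proof.
move=> us.
transitivity (\int[leb]_(v in unit_itv) \sum_(j <- s) \sum_(l <- s)
    (Re (c j * conjc (c l) * cis (2 * pi * (j - l)%:~R * v)) : R)%:E)%E.
  apply: eq_integral => v _.
  under [RHS]eq_bigr do rewrite sumEFin.
  rewrite sumEFin; congr EFin.
  set S := \sum_(j <- s) _ * _.
  have -> : normc S ^+ 2 = Re (S * conjc S) by rewrite sqr_normcE ReM ReJ ImJ; ring.
  rewrite {}/S. rewrite conjc_sum mulr_suml Re_sum; apply: eq_bigr => j _.
  rewrite mulr_sumr Re_sum; apply: eq_bigr => l _; congr (Re _).
  rewrite conjcM -cisN.
  have -> : 2 * pi * (j - l)%:~R * v = 2 * pi * j%:~R * v + - (2 * pi * l%:~R * v) :> R.
    by rewrite rmorphB/=; ring.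
  by rewrite cisD mulrACA.
have int_term (a : R[i]) (w : R) :
    leb.-integrable unit_itv (fun v : R => (Re (a * cis (w * v)))%:E).
  apply: continuous_compact_integrable; first exact: segment_compact.
  by apply: continuous_subspaceT; exact: continuous_Re_cis.
have m01 := @measurable_unit_itv R.
rewrite integral_sum//; last by move=> j; exact: integrable_sum.
rewrite -sumEFin; apply: eq_big_seq => j js.
rewrite integral_sum//.
under eq_bigr do rewrite integral_Re_cis subr_eq0.
(* As [s] has no duplicates, exactly one entry [l] equals [j]. *)
rewrite (bigD1_seq j)//= eqxx big1 ?adde0; last by move=> l /negbTE; rewrite eq_sym => ->.
by congr EFin; rewrite sqr_normcE ReM ReJ ImJ; ring.
Qed.

End trigonometric_polynomials.
(** * The algebra of amalgam functions *)

Section almost_everywhere_bounds.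
Context {R : realType}.
Local Open Scope ereal_scope.

(** The exceptional set is cut down to [D] in one direction and enlarged by the complement of [D],
    null for the restricted measure, in the other. *)
Lemma ae_mrestrP d (T : measurableType d) (mu : {measure set T -> \bar R})
    (D : set T) (mD : measurable D) (P : T -> Prop) :
  (\forall x \ae mrestr mu mD, P x) <-> (\forall x \ae mu, D x -> P x).
Proof.
split=> -[N [mN N0 PN]].
  exists (N `&` D); split => //; first exact: measurableI.
  by move=> x /= /not_implyP[Dx nPx]; split => //; exact: PN.
exists (N `|` ~` D); split.
- by apply: measurableU => //; exact: measurableC.
- rewrite /mrestr setIUl setICl setU0; apply: subset_measure0 N0 => //.
  exact: measurableI.
- move=> x /= nPx; have [Dx|nDx] := pselect (D x); last by right.
  by left; apply: PN => /= /(_ Dx).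
Qed.

Lemma ess_sup_lty_ex d (T : measurableType d) (mu : {measure set T -> \bar R})
    (f : T -> \bar R) : ess_sup mu f < +oo ->
  exists2 C : R, (0 < C)%R & \forall x \ae mu, f x <= C%:E.
Proof.
have fle := ess_sup_ge mu f.
case: (ess_sup mu f) fle => [r fle _|//|fle _].
  (* The essential supremum [r] may be zero or negative, whereas the constant has to be positive. *)
  exists (`|r| + 1)%R; first by rewrite ltr_wpDl.
  apply: filterS fle => x /le_trans; apply; rewrite lee_fin.
  by rewrite (le_trans (ler_norm _))// lerDl.
by exists 1%R => //; apply: filterS fle => x /le_trans; apply; exact: leNye.
Qed.

Lemma ess_sup_lty d (T : measurableType d) (mu : {measure set T -> \bar R})
    (f : T -> \bar R) (C : R) : (\forall x \ae mu, f x <= C%:E) ->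
  ess_sup mu f < +oo.
Proof. by move=> /ess_supP /le_lt_trans; apply; exact: ltry. Qed.

End almost_everywhere_bounds.

(** * Periodization bounds and closure properties of the amalgam space *)

Section amalgam_facts.
Context {R : realType}.
Local Notation leb := (@lebesgue_measure R).
Implicit Types (f g h : R -> R[i]).

(** The periodization of [u], with extended values so that it exists without any convergence
    assumption. *)
Definition orbit_sum (u : R -> R) (x : R) : \bar R :=
  \esum_(k in [set: int]) (u (x - k%:~R))%:E.

Definition orbit_bounded (u : R -> R) (C : R) : Prop :=
  \forall x \ae leb, unit_itv x -> (orbit_sum u x <= C%:E)%E.

Local Notation sqr_norm f := (fun x => normc (f x) ^+ 2).

Lemma amalgamP f : amalgam f <->
  cmeasurable setT f /\ exists2 C : R, 0 < C & orbit_bounded (sqr_norm f) C.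
Proof.
split=> [[mf /ess_sup_lty_ex[C C0 fC]]|[mf [C C0 fC]]]; split => //.
  by exists C => //; exact: (proj1 (ae_mrestrP _ (@measurable_unit_itv R) _) fC).
by apply: (@ess_sup_lty _ _ _ _ _ C); exact: (proj2 (ae_mrestrP _ (@measurable_unit_itv R) _) fC).
Qed.

Lemma orbit_sum_ge_term (u : R -> R) x (k : int) : (forall y, 0 <= u y) ->
  ((u (x - k%:~R))%:E <= orbit_sum u x)%E.
Proof.
move=> u0; have := @sum_le_esum R int [:: k] (fun k => (u (x - k%:~R))%:E).
by rewrite big_seq1; apply => // i; rewrite lee_fin.
Qed.

Lemma orbit_sum_shift (u : R -> R) x (n : int) :
  orbit_sum u (x - n%:~R) = orbit_sum u x.
Proof.
rewrite /orbit_sum -[RHS](esum_int_shift _ n); apply: eq_esum => k _.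
by rewrite intrD; congr (u _)%:E; ring.
Qed.

Lemma le_orbit_sumD (u v w : R -> R) (a b : R) x :
  0 <= a -> 0 <= b -> (forall y, 0 <= u y) -> (forall y, 0 <= v y) ->
  (forall y, w y <= a * u y + b * v y) ->
  (orbit_sum w x <= a%:E * orbit_sum u x + b%:E * orbit_sum v x)%E.
Proof.
move=> a0 b0 u0 v0 H; rewrite /orbit_sum -!esumZl//; try by move=> ?; rewrite lee_fin.
rewrite -esumD; try by move=> ? _; rewrite -EFinM lee_fin mulr_ge0.
by apply: le_esum => k _; rewrite -!EFinM -EFinD lee_fin.
Qed.

(** Common tool for sums, scalar multiples and the norm of a product: each is dominated pointwise by
    a nonnegative combination of squared norms. *)
Lemma orbit_boundedD (u v w : R -> R) (a b Cu Cv : R) :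
  0 <= a -> 0 <= b -> (forall y, 0 <= u y) -> (forall y, 0 <= v y) ->
  (forall y, w y <= a * u y + b * v y) ->
  orbit_bounded u Cu -> orbit_bounded v Cv ->
  orbit_bounded w (a * Cu + b * Cv).
Proof.
move=> a0 b0 u0 v0 H; apply: filterS2 => x hu hv x01.
apply: (le_trans (le_orbit_sumD x a0 b0 u0 v0 H)).
by rewrite EFinD !EFinM leeD// lee_wpmul2l ?lee_fin// ?hu ?hv.
Qed.

(** This is [|f g| <= (|f|^2 + |g|^2) / 2]. The resulting l^1 bound on orbits, stronger than the l^2
    bound of the amalgam, drives both the frame bound and membership in the Zak space. *)
Lemma orbit_bounded_normM f g : amalgam f -> amalgam g ->
  exists2 C : R, 0 < C & orbit_bounded (fun x => normc ((f \* g) x)) C.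
Proof.
move=> /amalgamP[_ [C C0 fC]] /amalgamP[_ [C' C'0 gC']].
exists (2^-1 * C + 2^-1 * C'); first by rewrite addr_gt0// mulr_gt0.
apply: (orbit_boundedD _ _ _ _ _ fC gC') => //; try by move=> y; exact: sqr_ge0.
move=> y /=; rewrite normcM.
have := sqr_ge0 (normc (f y) - normc (g y)); nra.
Qed.

(** A single term of an orbit sum is at most the whole sum, so [|f|^2 <= C] along almost every
    orbit, and this factor comes out of the sum for [f \* g]. *)
Lemma amalgamM f g : amalgam f -> amalgam g -> amalgam (f \* g).
Proof.
move=> /amalgamP[mf [C C0 fC]] /amalgamP[mg [C' C'0 gC']]; apply/amalgamP.
split; first exact: cmeasurableM.
exists (C * C'); first exact: mulr_gt0.
apply: filterS2 fC gC' => x hf hg x01.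
apply: (@le_trans _ _ (C%:E * orbit_sum (sqr_norm g) x)%E); last first.
  by rewrite EFinM lee_wpmul2l ?lee_fin ?(ltW C0)// hg.
rewrite /orbit_sum -esumZl ?(ltW C0)//; last by move=> k; rewrite lee_fin sqr_ge0.
apply: le_esum => k _; rewrite -EFinM lee_fin /= normcM exprMn.
rewrite ler_wpM2r ?sqr_ge0// -lee_fin (le_trans _ (hf x01))//.
by apply: (orbit_sum_ge_term _ _ (u := sqr_norm f)) => y; exact: sqr_ge0.
Qed.

Lemma amalgamD f g : amalgam f -> amalgam g -> amalgam (f \+ g).
Proof.
move=> /amalgamP[mf [C C0 fC]] /amalgamP[mg [C' C'0 gC']]; apply/amalgamP.
split; first exact: cmeasurableD.
exists (2 * C + 2 * C'); first by rewrite addr_gt0// mulr_gt0.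
apply: (orbit_boundedD _ _ _ _ _ fC gC') => //; try by move=> y; exact: sqr_ge0.
by move=> y; rewrite -mulrDr; exact: sqr_normcD_le.
Qed.

Lemma amalgamZ (c : R[i]) f : amalgam f -> amalgam (c \*o f).
Proof.
move=> /amalgamP[mf [C C0 fC]]; apply/amalgamP.
split; first by apply: cmeasurableM => //; exact: cmeasurable_cst.
(* The [1] keeps the constant positive when [c = 0]; the summand [0 * C] fits the two-term form of
   [orbit_boundedD]. *)
exists ((normc c ^+ 2 + 1) * C + 0 * C).
  by rewrite mul0r addr0 mulr_gt0// ltr_wpDl// sqr_ge0.
apply: (orbit_boundedD _ _ _ _ _ fC fC) => //; try by move=> y; exact: sqr_ge0.
  by rewrite addr_ge0// sqr_ge0.
by move=> y; rewrite mul0r addr0 /= normcM exprMn ler_wpM2r ?sqr_ge0// lerDl.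
Qed.

Lemma amalgam_cst0 : amalgam (cst 0 : R -> R[i]).
Proof.
apply/amalgamP; split; first exact: cmeasurable_cst.
exists 1 => //; apply: aeW => x _; rewrite /orbit_sum esum1//.
by move=> k _; rewrite normc0 expr0n.
Qed.

Lemma negligible_shift (N : set R) (c : R) : leb.-negligible N ->
  leb.-negligible [set x | N (x - c)].
Proof.
move=> [A [mA A0 NA]]; exists ((fun x : R => x - c) @^-1` A); split.
- by rewrite -[X in measurable X]setTI; exact: measurable_shift.
- exact: etrans (esym (lebesgue_measure_shift c mA)) A0.
- by move=> x /NA.
Qed.

(** The exceptional set is a countable union of translates of a null set. *)
Lemma ae_orbit (P : R -> Prop) : (\forall x \ae leb, P x) ->
  \forall x \ae leb, forall k : int, P (x - k%:~R).
Proof.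
move=> aeP; have [e [_ _ se]] := ex_set_bij_nat_int.
have aePe : \forall x \ae leb, forall n : nat, P (x - (e n)%:~R).
  by apply/ae_foralln => n; exact: (negligible_shift _ aeP).
apply: (filterS (F := almost_everywhere leb) _ aePe) => x H k;
by have [n _ <-] := se k I.
Qed.

Lemma ae_stable_amalgam : ae_stable (@amalgam R).
Proof.
move=> f g /amalgamP[mf [C C0 fC]] mg fg; apply/amalgamP; split => //.
exists C => //; apply: filterS2 fC (ae_orbit fg) => x hf efg x01.
by rewrite /orbit_sum (eq_esum (fun k _ => congr1 (fun z => (normc z ^+ 2)%:E) (esym (efg k)))) hf.
Qed.

Lemma function_algebra_amalgam : function_algebra (@amalgam R).
Proof.
split; last exact: amalgamM.
split; [by move=> f []|exact: ae_stable_amalgam|exact: amalgam_cst0|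
  exact: amalgamD|exact: amalgamZ].
Qed.

(** By periodization the squared L^2 norm is the integral over the unit interval of an orbit sum
    that is essentially at most [C]. *)
Lemma amalgam_L2 f : amalgam f -> L2 f.
Proof.
move=> /amalgamP[mf [C C0 fC]]; split => //; rewrite /L2_norm_sq.
have msq : measurable_fun setT (fun x => (normc (f x) ^+ 2)%:E).
  by apply/measurable_EFinP; exact: measurable_sqr_normc.
rewrite integral_periodization//; last by move=> x; rewrite lee_fin sqr_ge0.
apply: (@le_lt_trans _ _ (\int[leb]_(x in unit_itv) C%:E)%E); last first.
  by rewrite integral_cst ?[X in (_ * X)%E]lebesgue_unit_itv ?mule1 ?ltry//;
    exact: measurable_unit_itv.
apply: ae_ge0_le_integral => //; first exact: measurable_unit_itv.
- by move=> x _; apply: esum_ge0 => k _; rewrite lee_fin sqr_ge0.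
- apply: measurable_funTS; apply: (measurable_esum_shift msq) => x.
  by rewrite lee_fin sqr_ge0.
- by move=> x _; rewrite lee_fin ltW.
Qed.

End amalgam_facts.
(** * Frame bound *)

Section bessel_duality.
Context {R : realType}.
Local Notation leb := (@lebesgue_measure R).
Implicit Types (f g h : R -> R[i]).

Lemma measurable_EFin_sqr_normc h : cmeasurable setT h ->
  measurable_fun setT (fun x : R => (normc (h x) ^+ 2)%:E).
Proof. by move=> mh; apply/measurable_EFinP; exact: measurable_sqr_normc. Qed.

Lemma integrable_sqr_normc h : L2 h ->
  leb.-integrable setT (fun x => (normc (h x) ^+ 2)%:E).
Proof.
move=> [mh hoo]; apply/integrableP; split; first exact: measurable_EFin_sqr_normc.
by under eq_integral do rewrite gee0_abs ?lee_fin ?sqr_ge0//.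
Qed.

(** The dominating function is [|h|^2 + |f|^2]. The real function [u] will be the real or imaginary
    part of [h * conjc f]. *)
Lemma integrable_L2_mul h f (u : R -> R) : L2 h -> L2 f ->
  measurable_fun setT u -> (forall x, `|u x| <= normc (h x) * normc (f x)) ->
  leb.-integrable setT (fun x => (u x)%:E).
Proof.
move=> hL2 fL2 mu H.
have iD := integrableD measurableT (integrable_sqr_normc hL2) (integrable_sqr_normc fL2).
apply: (le_integrable _ _ _ iD) => //; first exact/measurable_EFinP.
move=> x _ /=; rewrite lee_fin (le_trans (H x))//.
rewrite [leRHS]ger0_norm; last by rewrite addr_ge0 ?sqr_ge0.
have := sqr_ge0 (normc (h x) - normc (f x)).
have := sqr_ge0 (normc (h x)); have := sqr_ge0 (normc (f x)); nra.
Qed.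

Lemma normc_conj (z : R[i]) : normc (conjc z) = normc z.
Proof. by case: z => a b /=; rewrite sqrrN. Qed.

Lemma integrable_Re_inner h f : L2 h -> L2 f ->
  leb.-integrable setT (fun x => (Re (h x * conjc (f x)))%:E).
Proof.
move=> hL2 fL2; apply: (integrable_L2_mul hL2 fL2).
  by apply: (proj1 (cmeasurableM _ (cmeasurable_conj _))); [exact: hL2.1|exact: fL2.1].
by move=> x; rewrite (le_trans (normr_Re_le _))// normcM normc_conj.
Qed.

Lemma integrable_Im_inner h f : L2 h -> L2 f ->
  leb.-integrable setT (fun x => (Im (h x * conjc (f x)))%:E).
Proof.
move=> hL2 fL2; apply: (integrable_L2_mul hL2 fL2).
  by apply: (proj2 (cmeasurableM _ (cmeasurable_conj _))); [exact: hL2.1|exact: fL2.1].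
by move=> x; rewrite (le_trans (normr_Im_le _))// normcM normc_conj.
Qed.

(* With [S = \sum_i <h, e_i> e_i] one has [\sum_i |<h, e_i>|^2 = Re <h, S>], and
   [2 Re <h, S> <= B |h|^2 + |S|^2 / B] by AM-GM. *)
Lemma bessel_of_synthesis (I : Type) (r : seq I) (e : I -> R -> R[i]) (B : R) :
  0 < B -> (forall i, L2 (e i)) ->
  (forall c : I -> R[i],
    (\int[leb]_x (normc (\sum_(i <- r) c i * e i x) ^+ 2)%:E
     <= (B * \sum_(i <- r) normc (c i) ^+ 2)%:E)%E) ->
  forall h, L2 h ->
  ((\sum_(i <- r) normc (inner h (e i)) ^+ 2)%:E <= B%:E * L2_norm_sq h)%E.
Proof.
move=> B0 eL2 synth h hL2.
pose c i := inner h (e i).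
pose S x := \sum_(i <- r) c i * e i x.
set T := \sum_(i <- r) _.
(* This is [Re (conjc (c i) * (h x * conjc (e i x)))]: it integrates to [|c i|^2], and summed over
   [i] it gives [Re (h x * conjc (S x))]. *)
pose F i x := Re (c i) * Re (h x * conjc (e i x)) + Im (c i) * Im (h x * conjc (e i x)).
have iF i : leb.-integrable setT (fun x => (F i x)%:E).
  rewrite /F; under eq_fun do rewrite EFinD !EFinM.
  apply: integrableD => //; apply: integrableZl => //.
    exact: integrable_Re_inner.
  exact: integrable_Im_inner.
have intF i : (\int[leb]_x (F i x)%:E = (normc (c i) ^+ 2)%:E)%E.
  rewrite /F; under eq_integral do rewrite EFinD !EFinM.
  rewrite integralD//; first last.
  - by apply: integrableZl => //; exact: integrable_Im_inner.
  - by apply: integrableZl => //; exact: integrable_Re_inner.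
  rewrite !integralZl//; first last.
  - exact: integrable_Re_inner.
  - exact: integrable_Im_inner.
  rewrite -[X in (_ * X + _)%E]fineK; last first.
    by apply: integrable_fin_num => //; exact: integrable_Re_inner.
  rewrite -[X in (_ + _ * X)%E]fineK; last first.
    by apply: integrable_fin_num => //; exact: integrable_Im_inner.
  by rewrite -!EFinM -EFinD sqr_normcE !expr2.
have sumF x : \sum_(i <- r) F i x = Re (h x * conjc (S x)).
  rewrite /S conjc_sum mulr_sumr Re_sum; apply: eq_bigr => i _.
  by rewrite /F conjcM !ReM !ImM !ReJ !ImJ ?ReM ?ImM; ring.
have TE : (T%:E = \int[leb]_x (\sum_(i <- r) F i x)%:E)%E.
  under eq_integral do rewrite -sumEFin.
  by rewrite integral_sum// -sumEFin; apply: eq_bigr => i _; rewrite intF.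
have mS : cmeasurable setT S.
  apply: cmeasurable_sum => i; apply: cmeasurableM; first exact: cmeasurable_cst.
  exact: (eL2 i).1.
have SL2 : L2 S.
  by split => //; apply: (le_lt_trans (synth c)); exact: ltry.
have key : (2%:E * T%:E <= B%:E * L2_norm_sq h + B^-1%:E * L2_norm_sq S)%E.
  rewrite TE -integralZl//; last first.
    by under eq_fun do rewrite -sumEFin; exact: integrable_sum.
  rewrite /L2_norm_sq -!integralZl//; try exact: integrable_sqr_normc.
  rewrite -integralD//; try by apply: integrableZl => //; exact: integrable_sqr_normc.
  apply: le_integral => //.
  - apply: integrableZl => //; under eq_fun do rewrite -sumEFin.
    exact: integrable_sum.
  - by apply: integrableD => //; apply: integrableZl => //; exact: integrable_sqr_normc.
  move=> x _; rewrite -!EFinM -EFinD lee_fin sumF.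
  have H : Re (h x * conjc (S x)) <= normc (h x) * normc (S x).
    by rewrite (le_trans (ler_norm _))// (le_trans (normr_Re_le _))// normcM normc_conj.
  (* After multiplication by [B], the difference between the right-hand side and [2 |h x| |S x|] is
     exactly this square. *)
  have := sqr_ge0 (B * normc (h x) - normc (S x)).
  rewrite -(ler_pM2l B0) mulrDr mulVKf ?gt_eqF//.
  nra.
have Sle : (B^-1%:E * L2_norm_sq S <= T%:E)%E.
  apply: (@le_trans _ _ (B^-1%:E * (B * T)%:E)%E).
    by rewrite lee_wpmul2l ?lee_fin ?invr_ge0 ?(ltW B0)//; exact: synth.
  by rewrite -EFinM mulKf// gt_eqF.
(* Here [2 T <= B |h|^2 + T], and [T] cancels because it is a real number. *)
have := le_trans key (leeD2l _ Sle).
by rewrite mule_natl mule2n leeD2rE.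
Qed.

End bessel_duality.

(** * Frame bound for Gabor systems with bounded periodization *)

Section gabor_frame_bound.
Context {R : realType}.
Local Notation leb := (@lebesgue_measure R).
Implicit Types (f g h : R -> R[i]).

Lemma weighted_cauchy_schwarz (I : Type) (r : seq I) (u w : I -> R) :
  (forall i, 0 <= u i) ->
  (\sum_(i <- r) u i * w i) ^+ 2
   <= (\sum_(i <- r) u i) * (\sum_(i <- r) u i * w i ^+ 2).
Proof.
move=> u0.
(* The induction step needs nonnegativity of [\sum_i u i * (w i - t) ^+ 2]. *)
suff [] : (forall t, 0 <= \sum_(i <- r) u i * w i ^+ 2
    - 2 * t * (\sum_(i <- r) u i * w i) + t ^+ 2 * \sum_(i <- r) u i) /\
  (\sum_(i <- r) u i * w i) ^+ 2
   <= (\sum_(i <- r) u i) * (\sum_(i <- r) u i * w i ^+ 2) by [].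
elim: r => [|i r [IH1 IH2]].
  by rewrite !big_nil; split=> [t|]; rewrite !mulr0 ?subr0 ?addr0 ?expr0n.
rewrite !big_cons.
set S1 := \sum_(_ <- r) _ in IH1 IH2 *; set S2 := \sum_(_ <- r) _ in IH1 IH2 *.
set S3 := \sum_(_ <- r) _ in IH1 IH2 *.
split=> [t|].
  have := IH1 t; have := mulr_ge0 (u0 i) (sqr_ge0 (w i - t)); nra.
(* The new difference of the two sides is the old one plus [u i] times the auxiliary expression at
   [t = w i]. *)
have := mulr_ge0 (u0 i) (IH1 (w i)); nra.
Qed.

Lemma L2_translation (a : R) f : L2 f -> L2 (translation a f).
Proof.
move=> [mf foo]; split.
  exact: (cmeasurable_comp mf (measurable_shift a)).
move: foo; rewrite /L2_norm_sq (integral_shift a measurableT (measurable_EFin_sqr_normc mf))//.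
by move=> x; rewrite lee_fin sqr_ge0.
Qed.

Lemma L2_modulation (b : R) f : L2 f -> L2 (modulation b f).
Proof.
move=> [mf foo]; split.
  apply: cmeasurableM => //; apply: cmeasurable_cis.
  exact: measurable_funM.
rewrite /L2_norm_sq; under eq_integral do rewrite normcM normc_cis mul1r.
exact: foo.
Qed.

(** The sum over [m] produces 1-periodic polynomials [p n]. Weighted Cauchy-Schwarz gives [|S (x -
    k)|^2 <= C \sum_n |p n x|^2 |f (x - k - n)|], and summation over [k] costs a second factor
    [C]. *)
Lemma gabor_synthesis f (C : R) (s t : seq int) (c : int -> int -> R[i]) :
  uniq s -> uniq t -> 0 <= C -> cmeasurable setT f ->
  orbit_bounded (fun x => normc (f x)) C ->
  (\int[leb]_x (normc (\sum_(n <- t) \sum_(m <- s)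
       c m n * modulation m%:~R (translation n%:~R f) x) ^+ 2)%:E
   <= (C ^+ 2 * \sum_(n <- t) \sum_(m <- s) normc (c m n) ^+ 2)%:E)%E.
Proof.
move=> us ut C0 mf fC.
pose p n (v : R) : R[i] := \sum_(m <- s) c m n * cis (2 * pi * m%:~R * v).
pose S (x : R) := \sum_(n <- t) f (x - n%:~R) * p n x.
have SE x : \sum_(n <- t) \sum_(m <- s) c m n * modulation m%:~R (translation n%:~R f) x = S x.
  apply: eq_bigr => n _; rewrite mulr_sumr; apply: eq_bigr => m _.
  by rewrite /modulation /translation mulrA mulrC.
under eq_integral do rewrite SE.
have mp n : cmeasurable setT (p n).
  apply: cmeasurable_sum => m; apply: cmeasurableM; first exact: cmeasurable_cst.
  by apply: cmeasurable_cis; exact: (measurable_funM (measurable_cst _) (@measurable_id _ _ _)).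
have mS : cmeasurable setT S.
  apply: cmeasurable_sum => n; apply: cmeasurableM => //.
  exact: (cmeasurable_comp mf (measurable_shift n%:~R)).
have mS2 := measurable_EFin_sqr_normc mS.
rewrite integral_periodization//; last by move=> x; rewrite lee_fin sqr_ge0.
pose Q (x : R) := \sum_(n <- t) normc (p n x) ^+ 2.
have mQ n : measurable_fun setT (fun x => (normc (p n x) ^+ 2)%:E).
  exact: measurable_EFin_sqr_normc.
(* By Parseval the integral of [C ^+ 2 * Q] is exactly the required bound, so comparing integrands
   almost everywhere is enough. *)
apply: (@le_trans _ _ (\int[leb]_(x in unit_itv) (C ^+ 2 * Q x)%:E)%E); last first.
  under eq_integral do rewrite EFinM -sumEFin.
  have m01 := @measurable_unit_itv R.
  rewrite ge0_integralZl//; first last.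
  - by rewrite lee_fin sqr_ge0.
  - by move=> x _; apply: sume_ge0 => n _; rewrite lee_fin sqr_ge0.
  - by apply: emeasurable_sum => n; exact: (measurable_funTS (mQ n)).
  rewrite ge0_integral_sum//; first last.
  - by move=> n x _; rewrite lee_fin sqr_ge0.
  - by move=> n; exact: (measurable_funTS (mQ n)).
  by under eq_bigr do rewrite parseval_trigonometric//; rewrite sumEFin -EFinM.
apply: ae_ge0_le_integral => //; first exact: measurable_unit_itv.
- by move=> x _; apply: esum_ge0 => k _; rewrite lee_fin sqr_ge0.
- apply: measurable_funTS; apply: (measurable_esum_shift mS2) => x.
  by rewrite lee_fin sqr_ge0.
- by move=> x _; rewrite lee_fin mulr_ge0 ?sqr_ge0// sumr_ge0// => n _; exact: sqr_ge0.
- apply: measurable_funTS; under eq_fun do rewrite EFinM -sumEFin.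
  by apply: emeasurable_funM => //; exact: emeasurable_sum.
apply: filterS fC => x hx x01.
have {}hx : (orbit_sum (fun x => normc (f x)) x <= C%:E)%E by exact: hx.
pose u (k n : int) := normc (f (x - k%:~R - n%:~R)).
have u0 k n : 0 <= u k n by exact: normc_ge0.
have pper n (k : int) : p n (x - k%:~R) = p n x.
  by apply: eq_bigr => m _; rewrite cis_periodic.
have term k : normc (S (x - k%:~R)) ^+ 2 <= C * \sum_(n <- t) normc (p n x) ^+ 2 * u k n.
  apply: (@le_trans _ _ ((\sum_(n <- t) u k n * normc (p n x)) ^+ 2)).
    rewrite ler_sqr ?nnegrE ?normc_ge0//; last first.
      by apply: sumr_ge0 => n _; rewrite mulr_ge0// normc_ge0.
    rewrite (le_trans (normc_sum_le _ _))// ler_sum// => n _.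
    by rewrite normcM pper.
  apply: (le_trans (weighted_cauchy_schwarz _ _ (u0 k))).
  under [X in _ <= C * X]eq_bigr do rewrite mulrC.
  rewrite ler_wpM2r//.
    by apply: sumr_ge0 => n _; rewrite mulr_ge0// sqr_ge0.
  (* The weights [u k n], for [n] in [t], are part of the orbit sum at [x - k], which equals the one
     at [x]. *)
  rewrite -lee_fin -sumEFin (le_trans _ hx)// -(orbit_sum_shift _ _ k).
  by apply: (sum_le_esum (a := fun n => (u k n)%:E)) => // n; rewrite lee_fin.
apply: (@le_trans _ _ (\esum_(k in [set: int])
    (C%:E * \sum_(n <- t) (normc (p n x) ^+ 2)%:E * (u k n)%:E)%E)).
  apply: le_esum => k _; under eq_bigr do rewrite -EFinM.
  by rewrite sumEFin -EFinM lee_fin.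
rewrite esumZl//; last first.
  by move=> k; apply: sume_ge0 => n _; rewrite -EFinM lee_fin mulr_ge0// sqr_ge0.
rewrite expr2 -mulrA [leRHS]EFinM.
have CE0 : (0 <= C%:E :> \bar R)%E by rewrite lee_fin.
apply: (lee_wpmul2l CE0).
rewrite esum_sum; last by move=> k n _ _; rewrite -EFinM lee_fin mulr_ge0// sqr_ge0.
rewrite /Q mulr_sumr -sumEFin; apply: lee_sum => n _.
rewrite esumZl ?sqr_ge0//; last by move=> k; rewrite lee_fin.
rewrite [in leRHS]mulrC [leRHS]EFinM.
have p0 : (0 <= (normc (p n x) ^+ 2)%:E :> \bar R)%E by rewrite lee_fin sqr_ge0.
apply: (lee_wpmul2l p0).
(* For fixed [n], the weights [u k n] over all [k] form the orbit sum at [x - n]. *)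
rewrite (le_trans _ hx)// -(orbit_sum_shift _ _ n) /orbit_sum.
by apply: le_esum => k _; rewrite /u lee_fin addrAC.
Qed.

Lemma finite_upper_frame_bound_orbit_bounded f (C : R) : 0 < C -> L2 f ->
  orbit_bounded (fun x => normc (f x)) C -> finite_upper_frame_bound f.
Proof.
move=> C0 fL2 fC; split => //; exists (C ^+ 2) => h hL2.
apply: esum_le => r ur.
pose s := undup (map fst r); pose t := undup (map snd r).
(* The finite index set is enlarged to a product grid. The swap makes translations the outer index,
   as in [gabor_synthesis], while pairs still read (modulation, translation). *)
pose rr := [seq (p.2, p.1) | p <- [seq (n, m) | n <- t, m <- s]].
have urr : uniq rr.
  rewrite map_inj_uniq; last by move=> [a b] [a' b'] [] -> ->.
  by apply: allpairs_uniq; rewrite ?undup_uniq// => -[a b] [a' b'] _ _ [] -> ->.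
have srr p : p \in r -> p \in rr.
  move=> pr; apply/mapP; exists (p.2, p.1); last by case: p {pr}.
  by apply/allpairsP; exists (p.2, p.1) => /=; rewrite !mem_undup !map_f.
pose e (p : int * int) := modulation (R := R) p.1%:~R (translation p.2%:~R f).
have eL2 p : L2 (e p) by exact/L2_modulation/L2_translation.
rewrite sumEFin.
apply: (@le_trans _ _ (\sum_(p <- rr) normc (inner h (e p)) ^+ 2)%:E).
  by rewrite lee_fin; apply: sumr_le_subset_uniq => // p; exact: sqr_ge0.
apply: bessel_of_synthesis => //; first exact: exprn_gt0.
move=> c; rewrite /rr big_map big_allpairs.
under eq_integral do rewrite big_map big_allpairs /=.
by apply: (@gabor_synthesis f C s t (fun m n => c (m, n))) => //; rewrite ?undup_uniq ?(ltW C0)//; exact: fL2.1.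
Qed.

End gabor_frame_bound.
(** * The Zak space *)

Section symmetric_sums.
Context {R : realType}.
Implicit Types (a b : int -> R).

Definition symmetric_range (n : nat) : seq int :=
  [seq j%:Z - n%:Z | j <- index_iota 0 n.*2.+1].

Lemma symmetric_range_uniq n : uniq (symmetric_range n).
Proof.
rewrite map_inj_uniq ?iota_uniq// => i j.
by move=> /addIr[].
Qed.

Lemma mem_symmetric_range n (k : int) : (k \in symmetric_range n) = (`|k|%N <= n)%N.
Proof.
apply/mapP/idP => [[j]|kn].
  by rewrite mem_index_iota leq0n => /andP[_ jn] ->; lia.
exists (absz (k + n%:Z)); last by lia.
by rewrite mem_index_iota leq0n; lia.
Qed.

Lemma symmetric_range_sub m n : (m <= n)%N ->
  {subset symmetric_range m <= symmetric_range n}.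
Proof. by move=> mn k; rewrite !mem_symmetric_range => /leq_trans; apply. Qed.

(** Lets a uniform bound on symmetric partial sums pass to the unordered sum [\esum]. *)
Lemma subset_symmetric_range (r : seq int) :
  exists n, {subset r <= symmetric_range n}.
Proof.
elim: r => [|k r [n IH]]; first by exists 0%N.
exists (maxn `|k|%N n) => l; rewrite inE mem_symmetric_range => /predU1P[->|/IH].
  exact: leq_maxl.
by rewrite mem_symmetric_range => /leq_trans; apply; exact: leq_maxr.
Qed.

(** Writing [a = (a + |a|) - |a|] leaves two families of nonnegative terms, whose symmetric sums are
    monotone and bounded by [2 * C] and [C]. *)
Lemma is_cvg_symmetric_sum a (C : R) :
  (\esum_(k in [set: int]) (`|a k|)%:E <= C%:E)%E ->
  cvgn (fun n => \sum_(k <- symmetric_range n) a k).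
Proof.
move=> aC.
have bnd n : \sum_(k <- symmetric_range n) `|a k| <= C.
  rewrite -lee_fin -sumEFin (le_trans _ aC)//.
  apply: (sum_le_esum (a := fun k => (`|a k|)%:E)) => [|k]; last by rewrite lee_fin.
  exact: symmetric_range_uniq.
have cvg_nneg b M : (forall k, 0 <= b k) ->
    (forall n, \sum_(k <- symmetric_range n) b k <= M) ->
    cvgn (fun n => \sum_(k <- symmetric_range n) b k).
  move=> b0 bM; apply: nondecreasing_is_cvgn.
    move=> m n mn; apply: sumr_le_subset_uniq => //; try exact: symmetric_range_uniq.
    exact: symmetric_range_sub.
  by exists M => _ [n _ <-].
have -> : (fun n => \sum_(k <- symmetric_range n) a k) =
    (fun n => \sum_(k <- symmetric_range n) (a k + `|a k|)) \-
    (fun n => \sum_(k <- symmetric_range n) `|a k|).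
  by apply/funext => n /=; rewrite -sumrB; apply: eq_bigr => k _; rewrite addrK.
apply: is_cvgB; last exact: (cvg_nneg _ C).
apply: (cvg_nneg _ (2 * C)) => [k|n].
  by rewrite -lerBlDr sub0r lerNl -normrN ler_norm.
rewrite mulr_natl mulr2n big_split/= lerD// (le_trans _ (bnd n))//.
by apply: ler_sum => k _; exact: ler_norm.
Qed.

End symmetric_sums.

(** * Null sets and Tonelli on products *)

Section product_facts.
Context {R : realType}.
Local Notation leb := (@lebesgue_measure R).
Local Open Scope ereal_scope.

Lemma ae_fst (P : R -> Prop) : (\forall t \ae leb, P t) ->
  \forall p \ae (leb \x leb), P p.1.
Proof.
move=> [N [mN N0 PN]]; exists (N `*` setT); split.
- exact: measurableX.
(* A null set times the whole line is null by the convention [0 * +oo = 0]. *)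
- by rewrite product_measure1E// [X in X * _]N0 mul0e.
- by move=> p /= nP; split => //; exact: PN.
Qed.

Lemma integral_setX (A B : set (measurableTypeR R))
    (G : measurableTypeR R * measurableTypeR R -> \bar R) :
  measurable A -> measurable B -> measurable_fun setT G -> (forall p, 0 <= G p) ->
  \int[leb \x leb]_(p in A `*` B) G p =
  \int[leb]_(x in A) \int[leb]_(y in B) G (x, y).
Proof.
move=> mA mB mG G0; rewrite integral_mkcond fubini_tonelli1; first last.
- by move=> p; rewrite patchE; case: ifP.
- by apply/(measurable_restrictT _ _).1; [exact: measurableX|exact: measurable_funTS].
rewrite [RHS]integral_mkcond; apply: eq_integral => x _; rewrite /fubini_F patchE.
case: ifPn => [xA|xA].
  rewrite [RHS]integral_mkcond; apply: eq_integral => y _; rewrite !patchE.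
  by rewrite in_setX xA.
by rewrite integral0_eq// => y _; rewrite patchE in_setX (negbTE xA).
Qed.

End product_facts.

(** * Symmetric partial sums of the Zak transform *)

Section zak_partial_sums.
Context {R : realType}.
Local Notation leb := (@lebesgue_measure R).
Implicit Types (f g : R -> R[i]) (F G : R * R -> R[i]).

Lemma zak_partialE f n (p : R * R) : zak_partial f n p =
  \sum_(k <- symmetric_range n) f (p.1 - k%:~R) * cis (2 * pi * k%:~R * p.2).
Proof. by rewrite /symmetric_range big_map big_mkord. Qed.

Lemma zak_partialD f g n p :
  zak_partial (f \+ g) n p = zak_partial f n p + zak_partial g n p.
Proof. by rewrite !zak_partialE -big_split; apply: eq_bigr => k _; rewrite /= mulrDl. Qed.

Lemma zak_partialZ (c : R[i]) f n p :
  zak_partial (c \*o f) n p = c * zak_partial f n p.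
Proof. by rewrite !zak_partialE mulr_sumr; apply: eq_bigr => k _; rewrite /= mulrA. Qed.

Lemma cmeasurable_zak_partial f n : cmeasurable setT f ->
  cmeasurable setT (zak_partial f n).
Proof.
move=> mf.
pose F (k : int) (p : measurableTypeR R * measurableTypeR R) : R[i] :=
  f (p.1 - k%:~R) * cis (2 * pi * k%:~R * p.2).
rewrite (_ : zak_partial f n = fun p => \sum_(k <- symmetric_range n) F k p).
  apply: cmeasurable_sum => k; apply: cmeasurableM.
    exact: (cmeasurable_comp mf (measurableT_comp (measurable_shift k%:~R) measurable_fst)).
  apply: cmeasurable_cis.
  exact: (measurable_funM (measurable_cst (2 * pi * k%:~R)) measurable_snd).
by apply/funext => p; exact: zak_partialE.
Qed.

Lemma normc_zak_partial_le f n p :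
  normc (zak_partial f n p) <= \sum_(k <- symmetric_range n) normc (f (p.1 - k%:~R)).
Proof.
rewrite zak_partialE (le_trans (normc_sum_le _ _))// ler_sum// => k _.
by rewrite normcM normc_cis mulr1.
Qed.

(** For fixed [t] the partial sum is a trigonometric polynomial in [v] with coefficients
    [f (t - k)]. *)
Lemma integral_sqr_zak_partial f n (t : R) :
  (\int[leb]_(v in unit_itv) (normc (zak_partial f n (t, v)) ^+ 2)%:E =
   (\sum_(k <- symmetric_range n) normc (f (t - k%:~R)) ^+ 2)%:E)%E.
Proof.
under eq_integral do rewrite zak_partialE /=.
by rewrite parseval_trigonometric// symmetric_range_uniq.
Qed.

End zak_partial_sums.

(** * The Zak space as a subspace of the amalgam space *)

Section zak_space_facts.
Context {R : realType}.
Local Notation leb := (@lebesgue_measure R).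
Implicit Types (f g : R -> R[i]) (F G : R * R -> R[i]).

Definition zak_error f F n : \bar R :=
  (\int[leb \x leb]_(p in unit_square) ((normc (zak_partial f n p - F p)) ^+ 2)%:E)%E.

Lemma zak_spaceP f : zak_space f <-> L2 f /\ exists F (C : R),
  [/\ 0 < C, cmeasurable unit_square F, zak_error f F @ \oo --> 0%E &
   \forall p \ae (leb \x leb)%E, unit_square p -> normc (F p) <= C].
Proof.
split=> -[fL2].
  move=> [F [mF Fcvg] /ess_sup_lty_ex[C C0 FC]]; split => //; exists F, C; split => //.
  exact: (proj1 (ae_mrestrP _ (@measurable_unit_square R) _) FC).
move=> [F [C [C0 mF Fcvg FC]]]; split => //; exists F => //.
apply: (@ess_sup_lty _ _ _ _ _ C).
exact: (proj2 (ae_mrestrP _ (@measurable_unit_square R) _) FC).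
Qed.

Lemma measurable_zak_error f F n : cmeasurable setT f -> cmeasurable unit_square F ->
  measurable_fun unit_square (fun p => ((normc (zak_partial f n p - F p)) ^+ 2)%:E).
Proof.
move=> mf mF; apply/measurable_EFinP; apply: measurable_sqr_normc.
have mz : cmeasurable unit_square (zak_partial f n).
  by have [? ?] := cmeasurable_zak_partial n mf; split; exact: measurable_funTS.
rewrite (_ : (fun p => _) = fun p => zak_partial f n p + (-1) * F p); last first.
  by apply/funext => p; rewrite mulN1r.
by apply: cmeasurableD => //; apply: cmeasurableM => //; exact: cmeasurable_cst.
Qed.

Lemma zak_error_ge0 f F n : (0 <= zak_error f F n)%E.
Proof. by apply: integral_ge0 => p _; rewrite lee_fin sqr_ge0. Qed.

Lemma zak_space_measurable : @zak_space R `<=` cmeasurable setT.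
Proof. by move=> f [[]]. Qed.

(** The same [F] serves for [g]: a partial sum at [p] only sees the orbit of [p.1], and [f] and [g]
    agree on almost every orbit. *)
Lemma ae_stable_zak_space : ae_stable (@zak_space R).
Proof.
move=> f g /zak_spaceP[[mf foo] [F [C [C0 mF Fcvg FC]]]] mg fg; apply/zak_spaceP.
split.
  split => //; move: foo; rewrite /L2_norm_sq.
  rewrite (@ge0_ae_eq_integral _ _ _ leb setT _ (fun x => (normc (g x) ^+ 2)%:E))//.
  - exact: measurable_EFin_sqr_normc.
  - exact: measurable_EFin_sqr_normc.
  - by move=> x _; rewrite lee_fin sqr_ge0.
  - by move=> x _; rewrite lee_fin sqr_ge0.
  - by apply: (filterS (F := almost_everywhere leb) _ fg) => x -> _.
exists F, C; split => //.
suff <- : zak_error f F = zak_error g F by [].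
apply/funext => n; apply: ge0_ae_eq_integral.
- exact: measurable_unit_square.
- exact: measurable_zak_error.
- exact: measurable_zak_error.
- by move=> x _; rewrite lee_fin sqr_ge0.
- by move=> x _; rewrite lee_fin sqr_ge0.
- apply: (filterS (F := almost_everywhere (leb \x leb)%E) _ (ae_fst (ae_orbit fg))) => p fgp _.
  rewrite !zak_partialE; congr ((normc (_ - _)) ^+ 2)%:E.
  by apply: eq_bigr => k _; rewrite fgp.
Qed.

Lemma L2D f g : L2 f -> L2 g -> L2 (f \+ g).
Proof.
move=> fL2 gL2; have mfg := cmeasurableD fL2.1 gL2.1; split => //.
have iD := integrableD measurableT (integrable_sqr_normc fL2) (integrable_sqr_normc gL2).
have iD2 := integrableZl measurableT 2 iD.
have : leb.-integrable setT (fun x => (normc ((f \+ g) x) ^+ 2)%:E).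
  apply: (le_integrable _ _ _ iD2) => //; first exact: measurable_EFin_sqr_normc.
  move=> x _ /=; rewrite lee_fin !ger0_norm ?sqr_ge0// ?mulr_ge0 ?addr_ge0 ?sqr_ge0//.
  exact: sqr_normcD_le.
move=> /integrableP[_]; apply: le_lt_trans.
by under [leRHS]eq_integral do rewrite gee0_abs ?lee_fin ?sqr_ge0//.
Qed.

Lemma L2Z (c : R[i]) f : L2 f -> L2 (c \*o f).
Proof.
move=> fL2; split; first exact: cmeasurableM (cmeasurable_cst _ _) fL2.1.
rewrite /L2_norm_sq; under eq_integral do rewrite normcM exprMn EFinM.
rewrite integralZl//; last exact: integrable_sqr_normc.
by rewrite lte_mul_pinfty ?lee_fin ?sqr_ge0//; exact: fL2.2.
Qed.

Lemma zak_spaceD f g : zak_space f -> zak_space g -> zak_space (f \+ g).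
Proof.
move=> /zak_spaceP[fL2 [F [C [C0 mF Fcvg FC]]]].
move=> /zak_spaceP[gL2 [G [D [D0 mG Gcvg GD]]]].
apply/zak_spaceP; split; first exact: L2D.
exists (F \+ G), (C + D); split.
- exact: addr_gt0.
- exact: cmeasurableD.
- have mf := measurable_zak_error _ fL2.1 mF; have mg := measurable_zak_error _ gL2.1 mG.
  apply: (@squeeze_cvge _ _ _ _ (cst 0%E) _
    (fun n => 2%:E * (zak_error f F n + zak_error g G n))%E).
  + apply: nearW => n; rewrite zak_error_ge0/= /zak_error.
    have mS := @measurable_unit_square R.
    rewrite -ge0_integralD//; try by move=> p _; rewrite lee_fin sqr_ge0.
    rewrite -ge0_integralZl//; first last.
    * by move=> p _; rewrite -EFinD lee_fin addr_ge0 ?sqr_ge0.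
    * exact: emeasurable_funD.
    apply: ge0_le_integral => //.
    * by move=> p _; rewrite lee_fin sqr_ge0.
    * apply: measurable_zak_error; last exact: cmeasurableD.
      exact: cmeasurableD fL2.1 gL2.1.
    * by apply: emeasurable_funM => //; exact: emeasurable_funD.
    move=> p _; rewrite -EFinD -EFinM lee_fin zak_partialD/= opprD addrACA.
    exact: sqr_normcD_le.
  + exact: cvg_cst.
  + rewrite -[X in _ --> X](_ : 2%:E * (0 + 0) = 0)%E; last by rewrite adde0 mule0.
    by apply: cvgeZl => //; exact: cvgeD.
- apply: filterS2 FC GD => p hF hG pS.
  by rewrite (le_trans (le_normcD _ _))// lerD ?hF ?hG.
Qed.

Lemma zak_spaceZ (c : R[i]) f : zak_space f -> zak_space (c \*o f).
Proof.
move=> /zak_spaceP[fL2 [F [C [C0 mF Fcvg FC]]]]; apply/zak_spaceP; split; first exact: L2Z.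
exists (fun p => c * F p), ((normc c + 1) * C); split.
- by rewrite mulr_gt0// ltr_wpDl// normc_ge0.
- exact: cmeasurableM (cmeasurable_cst _ _) mF.
- have -> : zak_error (c \*o f) (fun p => c * F p) =
      fun n => ((normc c ^+ 2)%:E * zak_error f F n)%E.
    apply/funext => n; rewrite /zak_error -ge0_integralZl ?lee_fin ?sqr_ge0//.
    + apply: eq_integral => p _; rewrite zak_partialZ -mulrBr.
      by rewrite normcM exprMn EFinM.
    + exact: measurable_unit_square.
    + exact: measurable_zak_error fL2.1 mF.
    + by move=> p _; rewrite lee_fin sqr_ge0.
  rewrite -[X in _ --> X](mule0 (normc c ^+ 2)%:E).
  exact: cvgeZl.
- apply: filterS FC => p hF pS; rewrite normcM ler_pM ?normc_ge0// ?hF//.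
  by rewrite lerDl.
Qed.

(* On [E `*` [0, 1]] with [E] the superlevel set of a partial orbit sum, Parseval
   and [|z|^2 <= 2 |z - F|^2 + 2 |F|^2] give
   [(2 C^2 + 1) leb E <= 2 (zak_error f F n) + 2 C^2 leb E] for large [n],
   which forces [leb E = 0]. *)
Lemma zak_space_amalgam f : zak_space f -> amalgam f.
Proof.
move=> /zak_spaceP[fL2 [F [C [C0 mF Fcvg FC]]]]; have mf := fL2.1.
apply/amalgamP; split => //.
pose s n (t : R) : R := \sum_(k <- symmetric_range n) normc (f (t - k%:~R)) ^+ 2.
have ms n : measurable_fun setT (s n).
  apply: measurable_sum => k; apply: measurable_sqr_normc.
  exact: (cmeasurable_comp mf (measurable_shift k%:~R)).
(* The bound on [F] accounts for [2 * C ^+ 2]; the extra [1] is what forces the superlevel sets to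
   be null. *)
exists (2 * C ^+ 2 + 1); first by rewrite ltr_wpDl// mulr_ge0// sqr_ge0.
(* Every finite set of integers lies in a symmetric range, so only countably many sums [s K] have to
   be bounded, each off its own null set. *)
suff : \forall t \ae leb, forall K, unit_itv t -> s K t <= 2 * C ^+ 2 + 1.
  apply: (filterS (F := almost_everywhere leb)) => t st t01.
  apply: esum_le => r ur; have [K rK] := subset_symmetric_range r.
  rewrite sumEFin lee_fin (le_trans _ (st K t01))//.
  apply: sumr_le_subset_uniq => //; first exact: symmetric_range_uniq.
  by move=> k; exact: sqr_ge0.
apply/ae_foralln => K.
pose E : set (measurableTypeR R) := unit_itv `&` [set t | 2 * C ^+ 2 + 1 <= s K t].
have m01 := @measurable_unit_itv R.
have mE : measurable E.
  rewrite (_ : E = unit_itv `&` [set t | ((2 * C ^+ 2 + 1)%:E <= (s K t)%:E)%E]); last first.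
    by apply/seteqP; split => t /=; rewrite lee_fin.
  apply: measurable_lee => //; apply/measurable_EFinP.
  exact: measurable_funTS (ms K).
have Eoo : leb E \is a fin_num.
  rewrite ge0_fin_numE// (@le_lt_trans _ _ (leb unit_itv))//.
    by apply: le_measure; rewrite ?inE// => t [].
  by rewrite lebesgue_unit_itv ltry.
suff E0 : leb E = 0%E.
  exists E; split => // t /= /not_implyP[t01 /negP]; rewrite -ltNge => /ltW.
  by split.
pose z n (p : R * R) := (normc (zak_partial f n p) ^+ 2)%:E.
have mz n : measurable_fun setT (z n).
  exact: (proj2 (measurable_EFinP _ _) (measurable_sqr_normc (cmeasurable_zak_partial n mf))).
have mEI : measurable (E `*` @unit_itv R) by apply: measurableX.
have EIS : E `*` unit_itv `<=` @unit_square R by move=> p /= [[? _] ?]; split.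
have PE : (leb \x leb)%E (E `*` @unit_itv R) = leb E.
  by rewrite product_measure1E// [X in (_ * X)%E]lebesgue_unit_itv mule1.
have lower n : (K <= n)%N ->
    ((2 * C ^+ 2 + 1)%:E * leb E <= \int[leb \x leb]_(p in E `*` unit_itv) z n p)%E.
  move=> Kn; rewrite (integral_setX mE m01 (mz n)); last by move=> p; rewrite lee_fin sqr_ge0.
  under eq_integral do rewrite integral_sqr_zak_partial.
  rewrite -integral_cst//; apply: ge0_le_integral => //.
  - by move=> t _; rewrite lee_fin ltW// ltr_wpDl// mulr_ge0// sqr_ge0.
  - by apply/measurable_EFinP; exact: measurable_funTS (ms n).
  - move=> t [t01 st]; rewrite lee_fin (le_trans st)//.
    apply: sumr_le_subset_uniq; try exact: symmetric_range_uniq.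
      exact: symmetric_range_sub.
    by move=> k; exact: sqr_ge0.
have upper n : (\int[leb \x leb]_(p in E `*` unit_itv) z n p <=
    2%:E * zak_error f F n + (2 * C ^+ 2)%:E * leb E)%E.
  have me := measurable_zak_error n mf mF.
  have meE := measurable_funS (@measurable_unit_square R) EIS me.
  have m2E := emeasurable_funM (measurable_cst 2%:E) meE.
  have e0 p : (0 <= ((normc (zak_partial f n p - F p)) ^+ 2)%:E :> \bar R)%E.
    by rewrite lee_fin sqr_ge0.
  apply: (@le_trans _ _ (\int[leb \x leb]_(p in E `*` unit_itv)
      (2%:E * ((normc (zak_partial f n p - F p)) ^+ 2)%:E + (2 * C ^+ 2)%:E))%E).
    apply: ae_ge0_le_integral => //.
    - by move=> p _; rewrite lee_fin sqr_ge0.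
    - exact: (measurable_funTS (mz n)).
    - by move=> p _; rewrite -EFinM -EFinD lee_fin addr_ge0// mulr_ge0// sqr_ge0.
    - exact: (emeasurable_funD m2E (measurable_cst _)).
    apply: filterS FC => p hF /EIS/hF FpC.
    rewrite -EFinM -EFinD lee_fin -mulrDr.
    rewrite -[X in normc X ^+ 2 <= _](subrK (F p)) (le_trans (sqr_normcD_le _ _))//.
    rewrite ler_pM2l// lerD2l ler_sqr ?nnegrE ?normc_ge0//.
    exact: ltW.
  rewrite ge0_integralD//; first last.
  - by move=> p _; rewrite lee_fin mulr_ge0// sqr_ge0.
  - by move=> p _; rewrite mule_ge0// lee_fin.
  rewrite integral_cst// [X in (_ + _ * X <= _)%E]PE leeD2r//.
  rewrite (ge0_integralZl _ mEI meE)//.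
  have two0 : (0 <= 2%:E :> \bar R)%E by rewrite lee_fin.
  apply: (lee_wpmul2l two0).
  by apply: ge0_subset_integral => //; exact: measurable_unit_square.
have half n : (K <= n)%N -> (2^-1%:E * leb E <= zak_error f F n)%E.
  move=> Kn; have := le_trans (lower n Kn) (upper n).
  (* Since [leb E] is finite, [(2 * C ^+ 2)%:E * leb E] cancels from both sides. *)
  rewrite EFinD muleDl ?fin_num_adde_defr// mul1e addeC leeD2rE ?fin_numM// => H.
  by rewrite lee_pdivrMl.
apply/eqP; rewrite eq_le measure_ge0 andbT.
have : (2^-1%:E * leb E <= 0)%E.
  rewrite -(cvg_lim _ Fcvg)//; apply: lime_ge; first exact: cvgP Fcvg.
  by exists K.
by rewrite lee_pdivrMl// mule0.
Qed.

Lemma zak_space_cst0 : zak_space (cst 0 : R -> R[i]).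
Proof.
apply/zak_spaceP; split; first exact/amalgam_L2/amalgam_cst0.
exists (cst 0), 1; split => //.
  rewrite (_ : zak_error _ _ = cst 0%E); first exact: cvg_cst.
  apply/funext => n; apply: integral0_eq => p _.
  by rewrite zak_partialE big1 ?subrr ?normc0 ?expr0n// => k _; rewrite mul0r.
by apply: aeW => p _; rewrite normc0.
Qed.

End zak_space_facts.

(** * Bounded Zak transforms from bounded periodizations *)

Section zak_transform_of_orbit_bounded.
Context {R : realType}.
Local Notation leb := (@lebesgue_measure R).
Implicit Types (f g : R -> R[i]).

Lemma zak_space_orbit_bounded f (C : R) : 0 < C -> L2 f ->
  orbit_bounded (fun x => normc (f x)) C -> zak_space f.
Proof.
move=> C0 fL2 fC; have mf := fL2.1.
pose nf (x : R) := normc (f x).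
pose A : set (measurableTypeR R) := [set t | (orbit_sum nf t <= C%:E)%E].
have mA : measurable A.
  rewrite -[A]setTI; apply: measurable_lee => //.
  have mnf : measurable_fun setT (fun x : R => (nf x)%:E).
    by apply/measurable_EFinP; exact: measurable_normc.
  by apply: (measurable_esum_shift mnf) => x; rewrite lee_fin normc_ge0.
pose z n (p : measurableTypeR R * measurableTypeR R) : R[i] := zak_partial f n p.
have mz n : cmeasurable setT (z n) by exact: cmeasurable_zak_partial.
have zC n p : A p.1 -> normc (z n p) <= C.
  move=> Ap; rewrite (le_trans (normc_zak_partial_le _ _ _))//.
  rewrite -lee_fin -sumEFin (le_trans _ Ap)//.
  apply: (sum_le_esum (a := fun k => (nf (p.1 - k%:~R))%:E)) => [|k].
    exact: symmetric_range_uniq.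
  by rewrite lee_fin normc_ge0.
(* [P] stands for [Re] or [Im]: convergence is proved for real sums, where [is_cvg_symmetric_sum]
   applies. *)
have cvg_part (P : R[i] -> R) p : A p.1 -> (forall w, `|P w| <= normc w) ->
    {morph P : x y / x + y} -> P 0 = 0 -> cvgn (fun n => P (z n p)).
  move=> Ap Ple PD P0.
  have -> : (fun n => P (z n p)) = (fun n => \sum_(k <- symmetric_range n)
      P (f (p.1 - k%:~R) * cis (2 * pi * k%:~R * p.2))).
    by apply/funext => n; rewrite /z zak_partialE (big_morph P PD P0).
  apply: (@is_cvg_symmetric_sum _ _ C); apply: le_trans Ap.
  apply: le_esum => k _; rewrite lee_fin (le_trans (Ple _))//.
  by rewrite normcM normc_cis mulr1.
have lim_le (P : R[i] -> R) p : A p.1 -> (forall w, `|P w| <= normc w) ->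
    cvgn (fun n => P (z n p)) -> `|limn (fun n => P (z n p))| <= C.
  move=> Ap Ple cP; have H n : `|P (z n p)| <= C by rewrite (le_trans (Ple _))// zC.
  rewrite ler_norml; apply/andP; split.
    by apply: limr_ge => //; apply: nearW => n; have := H n; rewrite ler_norml => /andP[].
  by apply: limr_le => //; apply: nearW => n; have := H n; rewrite ler_norml => /andP[].
(* The cutoff by [\1_A] makes [F] a pointwise limit of measurable functions on the whole plane,
   although [z n p] may diverge when [p.1] is outside [A]. *)
pose F (p : measurableTypeR R * measurableTypeR R) : R[i] :=
  (\1_A p.1 * limn (fun n => Re (z n p))) +i* (\1_A p.1 * limn (fun n => Im (z n p))).
have cRe p : A p.1 -> cvgn (fun n => Re (z n p)).
  by move=> Ap; apply: cvg_part => //; [exact: normr_Re_le|exact: ReD].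
have cIm p : A p.1 -> cvgn (fun n => Im (z n p)).
  by move=> Ap; apply: cvg_part => //; [exact: normr_Im_le|exact: ImD].
have mindic : measurable_fun setT (fun p : measurableTypeR R * measurableTypeR R => \1_A p.1 : R).
  exact: (measurableT_comp (measurable_indic mA) measurable_fst).
have mF : cmeasurable setT F.
  split.
    apply: (@measurable_fun_cvg _ _ _ _ (fun n p => \1_A p.1 * Re (z n p))).
      by move=> n; apply: measurable_funM => //; exact: (mz n).1.
    move=> p _; rewrite /F /= indicE; have [/set_mem Ap|_] := boolP (p.1 \in A).
      by rewrite !mul1r; under eq_fun do rewrite mul1r; exact: cRe.
    by rewrite mul0r; under eq_fun do rewrite mul0r; exact: cvg_cst.
  apply: (@measurable_fun_cvg _ _ _ _ (fun n p => \1_A p.1 * Im (z n p))).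
    by move=> n; apply: measurable_funM => //; exact: (mz n).2.
  move=> p _; rewrite /F /= indicE; have [/set_mem Ap|_] := boolP (p.1 \in A).
    by rewrite !mul1r; under eq_fun do rewrite mul1r; exact: cIm.
  by rewrite mul0r; under eq_fun do rewrite mul0r; exact: cvg_cst.
have mF1 : cmeasurable unit_square F.
  by have [? ?] := mF; split; exact: measurable_funTS.
(* Real and imaginary parts are each bounded by [C], whence the factor [2]. *)
have FC p : A p.1 -> normc (F p) <= 2 * C.
  move=> Ap; rewrite (le_trans (normc_le_ReIm _))// /F /= indicE mem_set// !mul1r.
  rewrite mulr_natl mulr2n lerD//; apply: lim_le => //.
  - exact: normr_Re_le.
  - exact: cRe.
  - exact: normr_Im_le.
  - exact: cIm.
have aeA : \forall p \ae (leb \x leb)%E, unit_square p -> A p.1.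
  apply: (filterS (F := almost_everywhere (leb \x leb)%E) _ (ae_fst fC)) => p Hp [p1 _].
  exact: Hp.
apply/zak_spaceP; split => //; exists F, (2 * C); split => //.
- exact: mulr_gt0.
- pose e n (p : measurableTypeR R * measurableTypeR R) := (normc (z n p - F p) ^+ 2)%:E.
  have me n : measurable_fun unit_square (e n) by exact: measurable_zak_error.
  have ecvg : \forall p \ae (leb \x leb)%E, unit_square p -> e ^~ p @ \oo --> 0%E.
    apply: filterS aeA => p pA /pA Ap; apply: cvg_EFin; first exact: nearW.
    rewrite (_ : _ \o _ = fun n => (Re (z n p) - Re (F p)) * (Re (z n p) - Re (F p)) +
                                   (Im (z n p) - Im (F p)) * (Im (z n p) - Im (F p))); last first.
      by apply/funext => n /=; rewrite sqr_normcE ReD ImD -!expr2.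
    have cR : Re (z n p) - Re (F p) @[n --> \oo] --> 0.
      rewrite -[X in _ --> X](subrr (Re (F p))); apply: cvgB; last exact: cvg_cst.
      by rewrite /F /= indicE mem_set// mul1r; exact: cRe.
    have cI : Im (z n p) - Im (F p) @[n --> \oo] --> 0.
      rewrite -[X in _ --> X](subrr (Im (F p))); apply: cvgB; last exact: cvg_cst.
      by rewrite /F /= indicE mem_set// mul1r; exact: cIm.
    rewrite -[X in _ --> X](_ : 0 * 0 + 0 * 0 = 0); last by rewrite mulr0 addr0.
    by apply: cvgD; apply: cvgM.
  (* The constant is [3 * C = C + 2 * C], from the bounds on [z n p] and on [F p]; constants are
     integrable on the unit square. *)
  have eC : \forall p \ae (leb \x leb)%E, forall n, unit_square p ->
      (`|e n p| <= ((3 * C) ^+ 2)%:E)%E.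
    apply: filterS aeA => p pA n /pA Ap.
    have C3 : 0 <= 3 * C by rewrite mulr_ge0// ltW.
    rewrite gee0_abs ?lee_fin ?sqr_ge0// ler_sqr ?nnegrE ?normc_ge0//.
    rewrite (le_trans (le_normcD _ _))// normcN.
    by have := zC n p Ap; have := FC p Ap; lra.
  have iC : (leb \x leb)%E.-integrable unit_square (cst ((3 * C) ^+ 2)%:E).
    apply/integrableP; split; first exact: measurable_cst.
    rewrite integral_cst; last exact: measurable_unit_square.
    have m01 := @measurable_unit_itv R.
    have S1 : (leb \x leb)%E (@unit_square R) = 1%E.
      by rewrite /unit_square product_measure1E// [X in (X * _)%E]lebesgue_unit_itv
        [X in (_ * X)%E]lebesgue_unit_itv mule1.
    by rewrite [X in (_ * X)%E]S1 mule1 ltry.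
  have [_ _] := dominated_convergence (@measurable_unit_square R) me
    (measurable_cst 0%E) ecvg iC eC.
  by rewrite integral0.
- by apply: filterS aeA => p pA /pA; exact: FC.
Qed.

End zak_transform_of_orbit_bounded.

Unset Implicit Arguments.

Theorem theorem4p6 (R : realType) :
  (forall f g : R -> R[i], amalgam f -> amalgam g ->
     finite_upper_frame_bound (f \* g)) /\
  is_ideal (@amalgam R) (@zak_space R).
Proof.
split=> [f g fA gA|].
  have [C C0 fgC] := orbit_bounded_normM fA gA.
  exact: finite_upper_frame_bound_orbit_bounded C0 (amalgam_L2 (amalgamM fA gA)) fgC.
split.
- exact: function_algebra_amalgam.
- split; [exact: zak_space_measurable|exact: ae_stable_zak_space|
    exact: zak_space_cst0|exact: zak_spaceD|exact: zak_spaceZ].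
- exact: zak_space_amalgam.
(* A Zak space factor lies in the amalgam, so [f \* g] is again a product of two amalgam functions
   and has bounded periodization. *)
- move=> f g fA /zak_space_amalgam gA.
  have [C C0 fgC] := orbit_bounded_normM fA gA.
  exact: zak_space_orbit_bounded C0 (amalgam_L2 (amalgamM fA gA)) fgC.
Qed.
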